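(* Let $G=\mathrm{Diff}(\mathbb R)$ with Lie algebra $\mathfrak g=\mathfrak X_c(\mathbb R)$, or $G=\mathrm{Diff}(S^1)$ with Lie algebra $\mathfrak g=\mathfrak X(S^1)$, with the right invariant weak Riemannian metric induced by $\langle X,Y\rangle=\int X(x)Y(x)\,dx$. Let $u$ be the right trivialized velocity field of a geodesic, so $u_t=-3u_xu$. Then a smooth right trivialized vector field $y$ along this geodesic is a Jacobi field if and only if $$y_{tt}=-3u^2y_{xx}-4uy_{tx}-2u_xy_t .$$
   Context: Vector fields $X\partial_x$ on $\mathbb R$ (with compact support) or on $S^1$ are identified with functions $X$; the Lie bracket is $[X,Y]=X'Y-XY'$ (the negative of the usual bracket of vector fields, i.e. the Lie algebra bracket of the diffeomorphism group). The group $\mathrm{Diff}(\mathbb R)$ is regarded as an infinite dimensional Lie group modeled on $C_c^\infty(\mathbb R,\mathbb R)$. Right trivialization identifies $T_gG$ with $\mathfrak g$ via $h\mapsto h\circ g^{-1}$, so for a curve $g(t)$ in $G$, $u=g_t\circ g^{-1}$. A Jacobi field along a geodesic is a vector field $y$ along it satisfying $\nabla_{\partial_t}\nabla_{\partial_t}y+\mathcal R(y,u)u=0$, where $\nabla$ is the Levi-Civita covariant derivative and $\mathcal R(X,Y)=[\nabla_X,\nabla_Y]-\nabla_{[X,Y]}$ its curvature; equivalently (in right trivialization) $y_{tt}=[\mathrm{ad}(y)^\top+\mathrm{ad}(y),\mathrm{ad}(u)^\top]u-\mathrm{ad}(u)^\top y_t-\alpha(u)y_t+\mathrm{ad}(u)y_t$,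 where $\mathrm{ad}(X)Y=[X,Y]$, $\mathrm{ad}(X)^\top$ is the adjoint with respect to $\langle\ ,\ \rangle$ and $\alpha(X)Z=\mathrm{ad}(Z)^\top X$. *)

(* Defs.v *)
From Stdlib Require Import Reals List ClassicalEpsilon.
From Coquelicot Require Import Coquelicot.
Open Scope R_scope.

(** Time runs over an open interval [(a, b)], bounded or not. *)
Definition in_itv (a b : Rbar) (t : R) : Prop := Rbar_lt a t /\ Rbar_lt t b.

(** Smoothness in one variable, and in [(t, x)] over [(a, b) x R]: all iterated
    partial derivatives, taken in any order, exist and are jointly continuous. *)
Definition smooth (X : R -> R) : Prop := forall n x, ex_derive_n X n x.

Inductive coord := Dt | Dx.

Fixpoint partials (w : list coord) (f : R -> R -> R) : R -> R -> R :=
  match w with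
  | nil => f
  | Dt :: w' => fun t x => Derive (fun s => partials w' f s x) t
  | Dx :: w' => fun t x => Derive (fun z => partials w' f t z) x
  end.

Definition smooth_itv (a b : Rbar) (f : R -> R -> R) : Prop :=
  forall (w : list coord) (t x : R), in_itv a b t ->
    ex_derive (fun s => partials w f s x) t /\
    ex_derive (fun z => partials w f t z) x /\
    continuity_2d_pt (partials w f) t x.

(** The base manifold. [Circle] is R / 2 pi Z: functions on it are 2 pi-periodic
    functions on R, and its diffeomorphisms are represented by their lifts to R. *)
Inductive base := Line | Circle.

(** The Lie algebra of compactly supported vector fields X d/dx. *)
Definition in_alg (M : base) (X : R -> R) : Prop :=
  smooth X /\
  match M with
  | Line => exists K, forall x, K < Rabs x -> X x = 0
  | Circle => forall x, X (x + 2 * PI) = X x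
  end.

(** Smooth curves in the Lie algebra. A smooth curve in the LF-space of test
    functions on R has, locally in time, its supports in one fixed compact set. *)
Definition alg_curve (M : base) (a b : Rbar) (y : R -> R -> R) : Prop :=
  smooth_itv a b y /\
  match M with
  | Line => forall c d, in_itv a b c -> in_itv a b d ->
      exists K, forall t x, c <= t <= d -> K < Rabs x -> y t x = 0
  | Circle => forall t x, in_itv a b t -> y t (x + 2 * PI) = y t x
  end.

Definition diffeo (phi : R -> R) : Prop :=
  smooth phi /\
  exists psi, smooth psi /\
    (forall x, psi (phi x) = x) /\ (forall x, phi (psi x) = x).

(** Smooth curves in Diff(M). Diff(R) is modeled on the test functions, so a
    smooth curve in it is, locally in time, constant off a compact set. On the
    circle the degree is 1 or -1. *)
Definition diff_curve (M : base) (a b : Rbar) (g : R -> R -> R) : Prop :=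
  smooth_itv a b g /\
  (forall t, in_itv a b t -> diffeo (g t)) /\
  match M with
  | Line => forall c d, in_itv a b c -> in_itv a b d ->
      exists K, forall s t x, c <= s <= d -> c <= t <= d ->
        K < Rabs x -> g s x = g t x
  | Circle => forall t, in_itv a b t ->
      exists e, (e = 1 \/ e = -1) /\
        forall x, g t (x + 2 * PI) = g t x + e * (2 * PI)
  end.

(** [u = g_t o g^-1]. *)
Definition right_velocity (a b : Rbar) (g u : R -> R -> R) : Prop :=
  forall t x, in_itv a b t -> u t (g t x) = Derive (fun s => g s x) t.

Definition inner (M : base) (X Y : R -> R) : R :=
  match M with
  | Line => RInt_gen (fun x => X x * Y x)
              (Rbar_locally m_infty) (Rbar_locally p_infty)
  | Circle => RInt (fun x => X x * Y x) 0 (2 * PI)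
  end.

Definition bracket (X Y : R -> R) : R -> R :=
  fun x => Derive X x * Y x - X x * Derive Y x.

(** The bracket, as vector fields on Diff(M), of the right invariant fields
    [phi |-> X o phi] and [phi |-> Y o phi] is the right invariant field of
    [- bracket X Y]. *)
Definition rbracket (X Y : R -> R) : R -> R := fun x => - bracket X Y x.

(** The Levi-Civita connection of the right invariant metric. Right translations
    are isometries, so the derivative of a right invariant field along another is
    right invariant: the connection is determined by a bilinear map on the Lie
    algebra. The inner product of two right invariant fields is constant on the
    group, which is why the left-hand side of the derivation rule
    [d<Y,Z>(X) = <nabla_X Y, Z> + <Y, nabla_X Z>] is zero. *)
Definition is_levi_civita (M : base)
    (nabla : (R -> R) -> (R -> R) -> R -> R) : Prop :=
  (forall X Y, in_alg M X -> in_alg M Y -> in_alg M (nabla X Y)) /\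
  (forall k X1 X2 Y x, in_alg M X1 -> in_alg M X2 -> in_alg M Y ->
     nabla (fun z => k * X1 z + X2 z) Y x = k * nabla X1 Y x + nabla X2 Y x) /\
  (forall k X Y1 Y2 x, in_alg M X -> in_alg M Y1 -> in_alg M Y2 ->
     nabla X (fun z => k * Y1 z + Y2 z) x = k * nabla X Y1 x + nabla X Y2 x) /\
  (forall X Y Z, in_alg M X -> in_alg M Y -> in_alg M Z ->
     0 = inner M (nabla X Y) Z + inner M Y (nabla X Z)) /\
  (forall X Y x, in_alg M X -> in_alg M Y ->
     nabla X Y x - nabla Y X x = rbracket X Y x).

(** On the Lie algebra the connection exists and is unique. *)
Definition levi_civita (M : base) : (R -> R) -> (R -> R) -> R -> R :=
  epsilon (inhabits (fun _ _ _ => 0)) (is_levi_civita M).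

(** The curvature is a tensor, so it is given by its value on right invariant
    fields. *)
Definition curvature (M : base) (X Y Z : R -> R) : R -> R :=
  let nabla := levi_civita M in
  fun x => nabla X (nabla Y Z) x - nabla Y (nabla X Z) x
           - nabla (rbracket X Y) Z x.

(** The covariant derivative of a right trivialized field [y] along a curve with
    right trivialized velocity [u]: expand [y] in right invariant fields and use
    the Leibniz rule. *)
Definition cov_t (M : base) (u y : R -> R -> R) : R -> R -> R :=
  fun t x => Derive (fun s => y s x) t + levi_civita M (u t) (y t) x.

(** [g] is a geodesic and [u] is its right trivialized velocity field. *)
Definition geodesic (M : base) (a b : Rbar) (g u : R -> R -> R) : Prop :=
  diff_curve M a b g /\
  alg_curve M a b u /\
  right_velocity a b g u /\
  forall t x, in_itv a b t -> cov_t M u u t x = 0.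

Definition jacobi (M : base) (a b : Rbar) (u y : R -> R -> R) : Prop :=
  forall t x, in_itv a b t ->
    cov_t M u (cov_t M u y) t x + curvature M (y t) (u t) (u t) x = 0.

(* Main.v *)
Require Import Defs.
From Stdlib Require Import Reals Lra Lia List FunctionalExtensionality ClassicalEpsilon.
From Coquelicot Require Import Coquelicot.
Open Scope R_scope.

(** The Levi-Civita connection of the right invariant L2 metric has a closed
    form on the Lie algebra,
      nabla_X Y = X' Y + 2 X Y',
    and once this is known the theorem is a computation.

    The closed form is torsion free because exchanging X and Y changes it by
    X Y' - X' Y, and metric because the sum of the two inner products in the
    metric condition is the integral of (2XYZ)', which vanishes by compact
    support or periodicity ([burgers_nabla_levi_civita]). Since
    [levi_civita] is chosen by description, uniqueness is needed as well: the
    difference of two connections is symmetric in its arguments and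
    skew for the metric, hence orthogonal to everything, in particular to
    itself, and the inner product is definite ([levi_civita_unique]).

    With the closed form, nabla_u u = 3 u u_x turns the geodesic equation into
    Burgers' equation. For the Jacobi operator, expanding the iterated covariant
    derivative gives
      y_tt + 2 u_x y_t + 4 u y_tx + 4 u^2 y_xx
        + (2 u_t + 8 u u_x) y_x + (u_tx + u_x^2 + 2 u u_xx) y,
    while the curvature ([curvature_formula]) is
      R(y,u)u = - u^2 y_xx - 2 u u_x y_x + (2 u_x^2 + u u_xx) y.
    Inserting Burgers' equation and its x-derivative, the terms in y_x and y
    cancel and the coefficient of y_xx drops to 3 u^2 ([jacobi_operator]). The
    remaining lemmas check that all fields met on the way are again in the Lie
    algebra, where the connection is determined, and that t- and x-derivatives
    commute. *)

(** * Smooth functions *)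

Lemma smooth_ex_derive X : smooth X -> forall x, ex_derive X x.
Proof. intros H x. exact (H 1%nat x). Qed.

Lemma smooth_continuous X : smooth X -> forall x, continuous X x.
Proof. intros H x. apply (ex_derive_continuous X), smooth_ex_derive, H. Qed.

Lemma ex_derive_n_SS X n x :
  ex_derive_n X (S (S n)) x <-> ex_derive_n (Derive X) (S n) x.
Proof.
  assert (E : forall y, Derive_n (Derive X) n y = Derive_n X (S n) y).
  { intros y. replace (S n) with (n + 1)%nat by lia.
    exact (Derive_n_comp X n 1 y). }
  simpl. split; intros H; (eapply ex_derive_ext; [|exact H]);
    intros y; simpl; [symmetry|]; apply E.
Qed.

Lemma smooth_Derive X : smooth X -> smooth (Derive X).
Proof.
  intros H [|n] x; [exact I|]. exact (proj1 (ex_derive_n_SS X n x) (H _ x)).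
Qed.

Lemma smooth_plus X Y : smooth X -> smooth Y -> smooth (fun x => X x + Y x).
Proof.
  intros HX HY n x.
  apply ex_derive_n_plus; apply filter_forall; intros; [apply HX|apply HY].
Qed.

Lemma smooth_scal k X : smooth X -> smooth (fun x => k * X x).
Proof. intros HX n x. apply ex_derive_n_scal_l, HX. Qed.

(** Induction on the order, for all pairs of functions at once, because the
    derivative of the product is again a sum of products. *)
Lemma smooth_mult X Y : smooth X -> smooth Y -> smooth (fun x => X x * Y x).
Proof.
  intros HX HY n. enough (H : forall k, (k <= n)%nat ->
    forall x, ex_derive_n (fun z => X z * Y z) k x) by (intros; apply H; lia).
  revert X Y HX HY. induction n as [|n IH]; intros X Y HX HY k Hk x.
  - replace k with 0%nat by lia. exact I.
  - destruct k as [|[|k]].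
    + exact I.
    + apply (ex_derive_mult X Y); apply smooth_ex_derive; assumption.
    + apply (proj2 (ex_derive_n_SS _ k x)).
      replace (Derive (fun z => X z * Y z))
        with (fun z => Derive X z * Y z + X z * Derive Y z).
      * apply ex_derive_n_plus; apply filter_forall; intros y j Hj;
          apply IH; auto using smooth_Derive; lia.
      * apply functional_extensionality; intros z. symmetry.
        apply Derive_mult; apply smooth_ex_derive; assumption.
Qed.

(** * The Lie algebra *)

Lemma Rabs_gt_locally K x : K < Rabs x -> locally x (fun y => K < Rabs y).
Proof.
  intros H. assert (Hd : 0 < Rabs x - K) by lra.
  exists (mkposreal _ Hd). change (forall y : R,
    Rabs (y - x) < Rabs x - K -> K < Rabs y). intros y Hy.
  assert (T := Rabs_triang (x - y) y). replace (x - y + y) with x in T by ring.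
  rewrite (Rabs_minus_sym x y) in T. lra.
Qed.

Lemma Derive_loc_zero f x : locally x (fun y => f y = 0) -> Derive f x = 0.
Proof.
  intros H. rewrite (Derive_ext_loc f (fun _ => 0) x H). apply Derive_const.
Qed.

Lemma Derive_shift f T x :
  (forall z, ex_derive f z) -> Derive (fun z => f (z + T)) x = Derive f (x + T).
Proof.
  intros H. apply is_derive_unique. auto_derive; [apply H|].
  change (fun x0 => f x0) with f. ring.
Qed.

Lemma in_alg_Derive M X : in_alg M X -> in_alg M (Derive X).
Proof.
  intros [HX HM]. split; [apply smooth_Derive, HX|]. destruct M.
  - destruct HM as [K HK]. exists K. intros x Hx. apply Derive_loc_zero.
    apply (filter_imp (fun y => K < Rabs y)); [exact HK|].
    apply Rabs_gt_locally, Hx.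
  - intros x. rewrite <- Derive_shift by apply smooth_ex_derive, HX.
    apply Derive_ext, HM.
Qed.

Lemma in_alg_plus M X Y :
  in_alg M X -> in_alg M Y -> in_alg M (fun x => X x + Y x).
Proof.
  intros [HX KX] [HY KY]. split; [apply smooth_plus; assumption|]. destruct M.
  - destruct KX as [K HK], KY as [L HL]. exists (Rmax K L). intros x Hx.
    assert (A := Rmax_l K L). assert (B := Rmax_r K L).
    rewrite HK, HL by lra. ring.
  - intros x. rewrite KX, KY. reflexivity.
Qed.

Lemma in_alg_scal M k X : in_alg M X -> in_alg M (fun x => k * X x).
Proof.
  intros [HX KX]. split; [apply smooth_scal, HX|]. destruct M.
  - destruct KX as [K HK]. exists K. intros x Hx. rewrite HK by exact Hx. ring.
  - intros x. rewrite KX. reflexivity.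
Qed.

Lemma in_alg_minus M X Y :
  in_alg M X -> in_alg M Y -> in_alg M (fun x => X x - Y x).
Proof.
  intros HX HY.
  replace (fun x => X x - Y x) with (fun x => X x + (-1) * Y x)
    by (apply functional_extensionality; intros; ring).
  auto using in_alg_plus, in_alg_scal.
Qed.

Lemma in_alg_mult M X Y :
  in_alg M X -> in_alg M Y -> in_alg M (fun x => X x * Y x).
Proof.
  intros [HX KX] [HY KY]. split; [apply smooth_mult; assumption|]. destruct M.
  - destruct KX as [K HK]. exists K. intros x Hx. rewrite HK by exact Hx. ring.
  - intros x. rewrite KX, KY. reflexivity.
Qed.

Lemma in_alg_ex_derive M X : in_alg M X -> forall x, ex_derive X x.
Proof. intros [H _]. apply smooth_ex_derive, H. Qed.

Lemma in_alg_continuous M X : in_alg M X -> forall x, continuous X x.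
Proof. intros [H _]. apply smooth_continuous, H. Qed.

Lemma in_alg_ex_RInt M X : in_alg M X -> forall c d, ex_RInt X c d.
Proof.
  intros H c d. apply (ex_RInt_continuous X). intros; apply (in_alg_continuous M), H.
Qed.

(** * Integration over the manifold *)

Definition integral (M : base) (f : R -> R) : R :=
  match M with
  | Line => RInt_gen f (Rbar_locally m_infty) (Rbar_locally p_infty)
  | Circle => RInt f 0 (2 * PI)
  end.

Lemma inner_integral M X Y : inner M X Y = integral M (fun x => X x * Y x).
Proof. destruct M; reflexivity. Qed.

Lemma RInt_vanish f c d :
  (forall x, Rmin c d < x < Rmax c d -> f x = 0) -> RInt f c d = 0.
Proof.
  intros H. rewrite (RInt_ext f (fun _ => 0)) by exact H.
  rewrite RInt_const. change ((d - c) * 0 = 0). ring.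
Qed.

Lemma integral_Line f K L :
  in_alg Line f -> (forall x, K < Rabs x -> f x = 0) -> 0 <= K -> K <= L ->
  integral Line f = RInt f (- L) L.
Proof.
  intros Hf HK H0 HL. simpl. apply is_RInt_gen_unique.
  intros P HP. assert (PL := locally_singleton _ _ HP).
  apply (Filter_prod _ _ _ (fun c => c < - L) (fun d => L < d)).
  - exists (- L). auto.
  - exists L. auto.
  - intros c d Hc Hd. exists (RInt f (- L) L). split; [|exact PL]. simpl.
    replace (RInt f (- L) L) with (RInt f c d).
    + apply (RInt_correct f), (in_alg_ex_RInt Line), Hf.
    + rewrite <- (RInt_Chasles f c (- L) d)
        by apply (in_alg_ex_RInt Line _ Hf).
      rewrite <- (RInt_Chasles f (- L) L d)
        by apply (in_alg_ex_RInt Line _ Hf).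
      rewrite (RInt_vanish f c), (RInt_vanish f L d).
      * change (0 + (RInt f (- L) L + 0) = RInt f (- L) L). ring.
      * intros x Hx. rewrite Rmin_left, Rmax_right in Hx by lra.
        apply HK. rewrite Rabs_right; lra.
      * intros x Hx. rewrite Rmin_left, Rmax_right in Hx by lra.
        apply HK. rewrite Rabs_left; lra.
Qed.

(** The bound on the support may be enlarged at will: this gives several
    functions a common interval of integration, with any given point inside. *)
Lemma Line_support f : in_alg Line f ->
  exists K, 0 <= K /\ (forall x, K < Rabs x -> f x = 0) /\
    forall L, K <= L -> integral Line f = RInt f (- L) L.
Proof.
  intros Hf. assert (H := Hf). destruct H as [_ [K HK]].
  assert (A := Rmax_l K 0). assert (B := Rmax_r K 0).
  assert (HK' : forall x, Rmax K 0 < Rabs x -> f x = 0).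
  { intros x Hx. apply HK. lra. }
  exists (Rmax K 0). repeat split; [lra|exact HK'|].
  intros L HL. apply (integral_Line f (Rmax K 0)); auto; lra.
Qed.

Lemma integral_plus M f g : in_alg M f -> in_alg M g ->
  integral M (fun x => f x + g x) = integral M f + integral M g.
Proof.
  intros Hf Hg. assert (Hfg := in_alg_plus M f g Hf Hg). destruct M.
  - destruct (Line_support f Hf) as (K1 & _ & _ & E1).
    destruct (Line_support g Hg) as (K2 & _ & _ & E2).
    destruct (Line_support _ Hfg) as (K3 & _ & _ & E3).
    pose (L := Rmax K1 (Rmax K2 K3)).
    assert (A := Rmax_l K1 (Rmax K2 K3)). assert (B := Rmax_r K1 (Rmax K2 K3)).
    assert (C := Rmax_l K2 K3). assert (D := Rmax_r K2 K3).
    rewrite (E1 L), (E2 L), (E3 L) by (unfold L; lra).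
    apply (RInt_plus f g); apply (in_alg_ex_RInt Line); assumption.
  - apply (RInt_plus f g); apply (in_alg_ex_RInt Circle); assumption.
Qed.

Lemma integral_Derive M f : in_alg M f -> integral M (Derive f) = 0.
Proof.
  intros Hf. assert (HD := in_alg_Derive M f Hf).
  assert (E : forall c d, RInt (Derive f) c d = f d - f c).
  { intros c d. apply RInt_Derive; intros.
    - apply (in_alg_ex_derive M), Hf.
    - apply (in_alg_continuous M), HD. }
  destruct M.
  - destruct (Line_support f Hf) as (K1 & P1 & V1 & _).
    destruct (Line_support _ HD) as (K2 & P2 & _ & E2).
    (* The extra 1 puts the endpoints strictly outside the support of f. *)
    rewrite (E2 (K1 + K2 + 1)), E by lra.
    rewrite !V1; [ring| |]; [rewrite Rabs_left | rewrite Rabs_right]; lra.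
  - destruct Hf as [_ Hp]. simpl. rewrite E, <- (Hp 0), Rplus_0_l. ring.
Qed.

Lemma RInt_period (f : R -> R) c : (forall x, f (x + 2 * PI) = f x) ->
  (forall p q, ex_RInt f p q) -> RInt f c (c + 2 * PI) = RInt f 0 (2 * PI).
Proof.
  intros Hp Hi.
  assert (E : RInt f (2 * PI) (c + 2 * PI) = RInt f 0 c).
  { assert (H := RInt_comp_lin f 1 (2 * PI) 0 c (Hi _ _)).
    rewrite Rmult_0_r, Rplus_0_l, Rmult_1_l in H. rewrite <- H.
    apply RInt_ext. intros x _.
    change (1 * f (1 * x + 2 * PI) = f x). rewrite !Rmult_1_l. apply Hp. }
  rewrite <- (RInt_Chasles f c 0) by apply Hi.
  rewrite <- (RInt_Chasles f 0 (2 * PI) (c + 2 * PI)) by apply Hi.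
  rewrite E. rewrite <- (opp_RInt_swap f) by apply Hi.
  change (- RInt f 0 c + (RInt f 0 (2 * PI) + RInt f 0 c) = RInt f 0 (2 * PI)).
  ring.
Qed.

Lemma RInt_nonneg_zero (f : R -> R) c d x : (forall y, continuous f y) ->
  (forall y, 0 <= f y) -> c < x < d -> RInt f c d = 0 -> f x = 0.
Proof.
  intros Hc Hpos Hx H0.
  assert (Hi : forall p q, ex_RInt f p q).
  { intros. apply (ex_RInt_continuous f). auto. }
  destruct (Hpos x) as [Hfx|]; [exfalso|congruence].
  assert (Hloc : locally x (fun y => 0 < f y)).
  { apply (Hc x). exact (open_gt 0 (f x) Hfx). }
  destruct Hloc as [e He].
  pose (r := Rmin (e / 2) (Rmin (x - c) (d - x))).
  assert (R1 := Rmin_l (e / 2) (Rmin (x - c) (d - x))).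
  assert (R2 := Rmin_r (e / 2) (Rmin (x - c) (d - x))).
  assert (R3 := Rmin_l (x - c) (d - x)). assert (R4 := Rmin_r (x - c) (d - x)).
  assert (Hr : 0 < r).
  { unfold r. apply Rmin_glb_lt; [|apply Rmin_glb_lt; lra].
    assert (P := cond_pos e). lra. }
  fold r in R1, R2. assert (Pe := cond_pos e).
  assert (I1 : 0 < RInt f (x - r) (x + r)).
  { apply RInt_gt_0; [lra| |auto]. intros y Hy. apply He.
    change (Rabs (y - x) < e). apply Rabs_def1; lra. }
  assert (I2 : 0 <= RInt f c (x - r)) by (apply RInt_ge_0; auto; lra).
  assert (I3 : 0 <= RInt f (x + r) d) by (apply RInt_ge_0; auto; lra).
  rewrite <- (RInt_Chasles f c (x - r) d) in H0 by apply Hi.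
  rewrite <- (RInt_Chasles f (x - r) (x + r) d) in H0 by apply Hi.
  change (RInt f c (x - r) + (RInt f (x - r) (x + r) + RInt f (x + r) d) = 0)
    in H0. lra.
Qed.

(** On the circle the interval of integration is first shifted so that the given
    point becomes interior to it. *)
Lemma inner_definite M X :
  in_alg M X -> inner M X X = 0 -> forall x, X x = 0.
Proof.
  intros HX H0 x. rewrite inner_integral in H0.
  assert (HXX := in_alg_mult M X X HX HX).
  enough (X x * X x = 0) by (apply Rsqr_0_uniq; assumption).
  assert (Hc := in_alg_continuous M _ HXX).
  assert (Hp : forall y, 0 <= X y * X y) by (intros; apply Rle_0_sqr).
  destruct M.
  - destruct (Line_support _ HXX) as (K & PK & _ & E).
    assert (A := Rle_abs x). assert (B := Rle_abs (- x)). rewrite Rabs_Ropp in B.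
    rewrite (E (K + Rabs x + 1)) in H0 by lra.
    apply (RInt_nonneg_zero (fun y => X y * X y) _ _ x Hc Hp) in H0;
      [exact H0|lra].
  - assert (P := PI_RGT_0).
    change (RInt (fun y => X y * X y) 0 (2 * PI) = 0) in H0.
    rewrite <- (RInt_period _ (x - PI)) in H0;
      [|apply HXX|apply (in_alg_ex_RInt Circle), HXX].
    apply (RInt_nonneg_zero (fun y => X y * X y) _ _ x Hc Hp) in H0;
      [exact H0|lra].
Qed.

Lemma inner_sym M X Y : inner M X Y = inner M Y X.
Proof.
  rewrite !inner_integral. f_equal.
  apply functional_extensionality; intros; ring.
Qed.

Lemma inner_minus_l M X1 X2 Y : in_alg M X1 -> in_alg M X2 -> in_alg M Y ->
  inner M (fun x => X1 x - X2 x) Y = inner M X1 Y - inner M X2 Y.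
Proof.
  intros H1 H2 HY. rewrite !inner_integral.
  assert (E := integral_plus M (fun x => (X1 x - X2 x) * Y x)
    (fun x => X2 x * Y x)
    (in_alg_mult _ _ _ (in_alg_minus _ _ _ H1 H2) HY)
    (in_alg_mult _ _ _ H2 HY)).
  cbv beta in E.
  replace (fun x => (X1 x - X2 x) * Y x + X2 x * Y x)
    with (fun x => X1 x * Y x) in E
    by (apply functional_extensionality; intros; ring).
  lra.
Qed.

(** * The Levi-Civita connection *)

(** The closed form of the connection, named after the geodesic equation
    u_t + nabla_u u = 0 that it gives. *)
Definition burgers_nabla (X Y : R -> R) : R -> R :=
  fun x => Derive X x * Y x + 2 * (X x * Derive Y x).

Lemma in_alg_burgers_nabla M X Y :
  in_alg M X -> in_alg M Y -> in_alg M (burgers_nabla X Y).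
Proof.
  intros HX HY. unfold burgers_nabla.
  auto using in_alg_plus, in_alg_scal, in_alg_mult, in_alg_Derive.
Qed.

Lemma Derive_lin k f g x : ex_derive f x -> ex_derive g x ->
  Derive (fun z => k * f z + g z) x = k * Derive f x + Derive g x.
Proof.
  intros Hf Hg. rewrite Derive_plus, Derive_scal; auto.
  apply (ex_derive_scal f), Hf.
Qed.

(** Both the x-derivative of [burgers_nabla] and its t-derivative along a curve
    have this shape. *)
Lemma derivative_two_products (A B C D : R -> R) x :
  ex_derive A x -> ex_derive B x -> ex_derive C x -> ex_derive D x ->
  ex_derive (fun z => A z * B z + 2 * (C z * D z)) x /\
  Derive (fun z => A z * B z + 2 * (C z * D z)) x
  = Derive A x * B x + A x * Derive B x
    + 2 * (Derive C x * D x + C x * Derive D x).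
Proof.
  intros HA HB HC HD. split; [auto_derive; tauto|].
  apply is_derive_unique. auto_derive; [tauto|].
  change (fun x0 => A x0) with A. change (fun x0 => B x0) with B.
  change (fun x0 => C x0) with C. change (fun x0 => D x0) with D. ring.
Qed.

Lemma Derive_burgers_nabla M X Y x : in_alg M X -> in_alg M Y ->
  Derive (burgers_nabla X Y) x
  = Derive (Derive X) x * Y x + 3 * (Derive X x * Derive Y x)
    + 2 * (X x * Derive (Derive Y) x).
Proof.
  intros HX HY. unfold burgers_nabla.
  edestruct (derivative_two_products (Derive X) Y X (Derive Y) x) as [_ E];
    [..|rewrite E; ring]; apply (in_alg_ex_derive M); auto using in_alg_Derive.
Qed.

(** The two inner products in the metric condition add up to the integral of the
    derivative of 2XYZ. *)
Lemma burgers_nabla_levi_civita M : is_levi_civita M burgers_nabla.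
Proof.
  split; [|split; [|split; [|split]]].
  - exact (in_alg_burgers_nabla M).
  - intros k X1 X2 Y x H1 H2 HY. unfold burgers_nabla.
    rewrite Derive_lin by (apply (in_alg_ex_derive M); assumption). ring.
  - intros k X Y1 Y2 x HX H1 H2. unfold burgers_nabla.
    rewrite Derive_lin by (apply (in_alg_ex_derive M); assumption). ring.
  - intros X Y Z HX HY HZ. rewrite !inner_integral.
    rewrite <- integral_plus
      by auto using in_alg_mult, in_alg_burgers_nabla.
    assert (HYZ := in_alg_mult M Y Z HY HZ).
    assert (HXYZ := in_alg_mult M X _ HX HYZ).
    rewrite <- (integral_Derive M _ (in_alg_scal M 2 _ HXYZ)). f_equal.
    apply functional_extensionality; intros x.
    rewrite Derive_scal, Derive_mult, (Derive_mult Y Z)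
      by (apply (in_alg_ex_derive M); assumption).
    unfold burgers_nabla. ring.
  - intros X Y x HX HY. unfold burgers_nabla, rbracket, bracket. ring.
Qed.

(** The difference B of two connections is symmetric because the torsion
    conditions cancel, and <B(X,Y),Z> is skew in Y and Z. A trilinear form that
    is symmetric in one pair and skew in an overlapping pair vanishes: exchanging
    arguments three times brings it back with the opposite sign. With Z = B(X,Y)
    this says that B(X,Y) has norm zero. *)
Lemma levi_civita_unique M n1 n2 X Y x :
  is_levi_civita M n1 -> is_levi_civita M n2 ->
  in_alg M X -> in_alg M Y -> n1 X Y x = n2 X Y x.
Proof.
  intros (A1 & _ & _ & S1 & T1) (A2 & _ & _ & S2 & T2) HX HY.
  pose (B := fun X Y z => n1 X Y z - n2 X Y z).
  assert (HB : forall X Y, in_alg M X -> in_alg M Y -> in_alg M (B X Y)).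
  { intros. apply in_alg_minus; auto. }
  assert (Bsym : forall X Y, in_alg M X -> in_alg M Y -> B X Y = B Y X).
  { intros P Q HP HQ. apply functional_extensionality; intros z. unfold B.
    assert (E1 := T1 P Q z HP HQ). assert (E2 := T2 P Q z HP HQ). lra. }
  assert (Bskew : forall X Y Z, in_alg M X -> in_alg M Y -> in_alg M Z ->
    inner M (B X Y) Z = - inner M (B X Z) Y).
  { intros P Q W HP HQ HW. unfold B. rewrite !inner_minus_l by auto.
    assert (E1 := S1 P Q W HP HQ HW). assert (E2 := S2 P Q W HP HQ HW).
    rewrite (inner_sym M Q) in E1. rewrite (inner_sym M Q) in E2. lra. }
  assert (Z0 : inner M (B X Y) (B X Y) = 0).
  { assert (HZ := HB X Y HX HY). set (Z := B X Y) in HZ |- * at 2.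
    assert (E1 := Bskew X Y Z HX HY HZ). assert (E2 := Bskew Z X Y HZ HX HY).
    assert (E3 := Bskew Y Z X HY HZ HX).
    rewrite (Bsym X Z) in E1 by auto. rewrite (Bsym Z Y) in E2 by auto.
    rewrite (Bsym Y X) in E3 by auto. lra. }
  assert (E := inner_definite M _ (HB X Y HX HY) Z0 x). unfold B in E. lra.
Qed.

Lemma levi_civita_eq M X Y : in_alg M X -> in_alg M Y ->
  levi_civita M X Y = burgers_nabla X Y.
Proof.
  intros HX HY. apply functional_extensionality; intros x.
  apply (levi_civita_unique M); auto using burgers_nabla_levi_civita.
  apply (epsilon_spec (inhabits (fun _ _ _ => 0)) (is_levi_civita M)).
  exists burgers_nabla. apply burgers_nabla_levi_civita.
Qed.

Lemma curvature_formula M X Y x : in_alg M X -> in_alg M Y ->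
  curvature M X Y Y x
  = - Y x ^ 2 * Derive (Derive X) x - 2 * (Y x * Derive Y x * Derive X x)
    + (2 * Derive Y x ^ 2 + Y x * Derive (Derive Y) x) * X x.
Proof.
  intros HX HY. assert (HDX := in_alg_Derive M X HX).
  assert (HDY := in_alg_Derive M Y HY).
  assert (Eb : rbracket X Y = fun z => X z * Derive Y z - Derive X z * Y z).
  { apply functional_extensionality; intros z. unfold rbracket, bracket. ring. }
  assert (Hb : in_alg M (rbracket X Y)).
  { rewrite Eb. auto using in_alg_minus, in_alg_mult. }
  unfold curvature. rewrite !(levi_civita_eq M) by
    (rewrite ?(levi_civita_eq M); auto using in_alg_burgers_nabla).
  (* Only the outer connections: the inner ones stay folded under the
     derivative, which [Derive_burgers_nabla] evaluates. *)
  unfold burgers_nabla at 1 3 5. rewrite Eb.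
  rewrite !(Derive_burgers_nabla M), Derive_minus, !Derive_mult
    by (apply (in_alg_ex_derive M) || idtac; auto using in_alg_mult).
  unfold burgers_nabla. ring.
Qed.

(** * Curves in the Lie algebra *)

Lemma in_itv_locally a b t : in_itv a b t -> locally t (in_itv a b).
Proof.
  intros [Ha Hb]. apply (locally_interval _ t a b Ha Hb). split; assumption.
Qed.

Lemma partials_app w v f : partials (w ++ v) f = partials w (partials v f).
Proof.
  induction w as [|[] w IH]; [reflexivity| |]; simpl; rewrite IH; reflexivity.
Qed.

Lemma smooth_itv_partials a b f v :
  smooth_itv a b f -> smooth_itv a b (partials v f).
Proof. intros H w. rewrite <- partials_app. apply H. Qed.

Lemma smooth_itv_slice a b f t :
  smooth_itv a b f -> in_itv a b t -> smooth (f t).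
Proof.
  intros H Ht.
  assert (E : forall n x, Derive_n (f t) n x = partials (repeat Defs.Dx n) f t x).
  { induction n as [|n IH]; intros x; [reflexivity|]. simpl.
    apply Derive_ext, IH. }
  intros [|n] x; [exact I|]. simpl.
  apply (ex_derive_ext (fun z => partials (repeat Defs.Dx n) f t z)).
  - intros z. symmetry. apply E.
  - apply H, Ht.
Qed.

(** Schwarz's theorem; its hypotheses in a neighbourhood hold because the time
    interval is open. *)
Lemma smooth_itv_mixed a b f t x : smooth_itv a b f -> in_itv a b t ->
  Derive (fun s => Derive (fun z => f s z) x) t
  = Derive (fun z => Derive (fun s => f s z) t) x.
Proof.
  intros H Ht. apply Schwarz.
  - destruct (in_itv_locally a b t Ht) as [e He]. exists e.
    intros p q Hp _. assert (Hi : in_itv a b p) by (apply He, Hp).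
    exact (conj (proj1 (H nil p q Hi)) (conj (proj1 (proj2 (H nil p q Hi)))
      (conj (proj1 (H (Defs.Dx :: nil) p q Hi))
        (proj1 (proj2 (H (Dt :: nil) p q Hi)))))).
  - exact (proj2 (proj2 (H (Dt :: Defs.Dx :: nil) t x Ht))).
  - exact (proj2 (proj2 (H (Defs.Dx :: Dt :: nil) t x Ht))).
Qed.

Lemma alg_curve_in_alg M a b y t :
  alg_curve M a b y -> in_itv a b t -> in_alg M (y t).
Proof.
  intros [Hs Hy] Ht. split; [apply (smooth_itv_slice a b); assumption|].
  destruct M.
  - destruct (Hy t t Ht Ht) as [K HK]. exists K. intros x Hx.
    apply HK; [lra|exact Hx].
  - intros x. apply Hy, Ht.
Qed.

(** The support condition is uniform on compact time intervals, so near a given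
    time the curve vanishes identically at each point far out. *)
Lemma alg_curve_velocity_in_alg M a b y t : alg_curve M a b y ->
  in_itv a b t -> in_alg M (fun x => Derive (fun s => y s x) t).
Proof.
  intros [Hs Hy] Ht. split.
  - apply (smooth_itv_slice a b (partials (Dt :: nil) y)); [|exact Ht].
    apply smooth_itv_partials, Hs.
  - destruct (in_itv_locally a b t Ht) as [e He]. destruct M.
    + assert (P := cond_pos e).
      destruct (Hy (t - e / 2) (t + e / 2)) as [K HK].
      * apply He. change (Rabs (t - e / 2 - t) < e). apply Rabs_def1; lra.
      * apply He. change (Rabs (t + e / 2 - t) < e). apply Rabs_def1; lra.
      * exists K. intros x Hx. apply Derive_loc_zero.
        apply (locally_interval _ t (t - e / 2) (t + e / 2)); simpl; try lra.
        intros s H1 H2. apply HK; [lra|exact Hx].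
    + intros x. apply Derive_ext_loc. exists e. intros s Hse. apply Hy, He, Hse.
Qed.

(** * The Jacobi equation *)

(** An equality of functions of x, so that it can be rewritten inside the
    iterated covariant derivative, where [levi_civita] sees a whole function. *)
Lemma cov_t_eq M a b u y t : alg_curve M a b u -> alg_curve M a b y ->
  in_itv a b t ->
  cov_t M u y t
  = fun x => Derive (fun s => y s x) t + burgers_nabla (u t) (y t) x.
Proof.
  intros Hu Hy Ht. unfold cov_t. apply functional_extensionality; intros x.
  rewrite (levi_civita_eq M) by (apply (alg_curve_in_alg M a b); assumption).
  reflexivity.
Qed.

Lemma burgers_equation M a b g u t x : geodesic M a b g u -> in_itv a b t ->
  Derive (fun s => u s x) t = -3 * Derive (fun z => u t z) x * u t x.
Proof.
  intros (_ & Hu & _ & Hg) Ht. assert (E := Hg t x Ht).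
  rewrite (cov_t_eq M a b) in E by assumption. unfold burgers_nabla in E.
  change (fun z => u t z) with (u t). lra.
Qed.

(** The left-hand side of the Jacobi equation along a solution of Burgers'
    equation. The latter is used at all points of the slice, since its
    x-derivative gives the mixed derivative of u. *)
Lemma jacobi_operator M a b u y t x :
  alg_curve M a b u -> alg_curve M a b y -> in_itv a b t ->
  (forall z, Derive (fun s => u s z) t = -3 * Derive (u t) z * u t z) ->
  cov_t M u (cov_t M u y) t x + curvature M (y t) (u t) (u t) x
  = Derive (fun s => Derive (fun r => y r x) s) t
    + 3 * u t x ^ 2 * Derive (Derive (y t)) x
    + 4 * u t x * Derive (fun z => Derive (fun s => y s z) t) x
    + 2 * Derive (u t) x * Derive (fun s => y s x) t.
Proof.
  intros Hu Hy Ht Hgeo.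
  assert (Au := alg_curve_in_alg M a b u t Hu Ht).
  assert (Ay := alg_curve_in_alg M a b y t Hy Ht).
  assert (Ayt := alg_curve_velocity_in_alg M a b y t Hy Ht).
  assert (An := in_alg_burgers_nabla M _ _ Au Ay).
  assert (Du := fun w => proj1 (proj1 Hu w t x Ht)).
  assert (Dy := fun w => proj1 (proj1 Hy w t x Ht)).
  assert (Eutx : Derive (fun s => Derive (u s) x) t
      = -3 * (Derive (Derive (u t)) x * u t x + Derive (u t) x ^ 2)).
  { assert (E := smooth_itv_mixed a b u t x (proj1 Hu) Ht).
    change (fun s => Derive (fun z => u s z) x)
      with (fun s => Derive (u s) x) in E.
    rewrite E, (Derive_ext _ _ x Hgeo).
    rewrite (Derive_ext _ (fun z => -3 * (Derive (u t) z * u t z)))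
      by (intros; ring).
    rewrite Derive_scal, Derive_mult
      by (apply (in_alg_ex_derive M); auto using in_alg_Derive). ring. }
  assert (Eytx := smooth_itv_mixed a b y t x (proj1 Hy) Ht).
  change (fun s => Derive (fun z => y s z) x)
    with (fun s => Derive (y s) x) in Eytx.
  unfold cov_t at 1.
  (* The outer covariant derivative needs the inner one at nearby times for its
     t-derivative, and as a function of x at time t for the connection term. *)
  rewrite (Derive_ext_loc (fun s => cov_t M u y s x)
    (fun s => Derive (fun r => y r x) s
       + (Derive (u s) x * y s x + 2 * (u s x * Derive (y s) x)))).
  2:{ apply (filter_imp (in_itv a b)); [|apply in_itv_locally, Ht].
      intros s Hs. rewrite (cov_t_eq M a b) by assumption. reflexivity. }
  rewrite (cov_t_eq M a b), (levi_civita_eq M), (curvature_formula M)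
    by auto using in_alg_plus.
  assert (Dux := Du (Defs.Dx :: nil)). assert (Dyx := Dy (Defs.Dx :: nil)).
  assert (Dyt := Dy (Dt :: nil)). specialize (Du nil). specialize (Dy nil).
  simpl in Du, Dy, Dux, Dyx, Dyt.
  destruct (derivative_two_products (fun s => Derive (u s) x)
    (fun s => y s x) (fun s => u s x) (fun s => Derive (y s) x) t
    Dux Dy Du Dyx) as [Exn En].
  rewrite Derive_plus, En by assumption.
  unfold burgers_nabla at 1.
  rewrite Derive_plus by (apply (in_alg_ex_derive M); assumption).
  rewrite (Derive_burgers_nabla M) by assumption.
  rewrite Eutx, Eytx, Hgeo. unfold burgers_nabla.
  change (fun s => Derive (fun r => y r x) s) with (Derive (fun r => y r x)).
  set (Ytx := Derive (fun z => Derive (fun s => y s z) t) x).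
  set (Yt := Derive (fun s => y s x) t). set (Ytt := Derive (Derive _) t).
  ring.
Qed.

Theorem mainTheorem8 (M : base) (a b : Rbar) (g u : R -> R -> R)
    (Hgu : geodesic M a b g u) :
  (forall t x, in_itv a b t ->
     Derive (fun s => u s x) t = -3 * Derive (fun z => u t z) x * u t x) /\
  (forall y : R -> R -> R, alg_curve M a b y ->
     (jacobi M a b u y <->
      forall t x, in_itv a b t ->
        Derive_n (fun s => y s x) 2 t
        = -3 * u t x ^ 2 * Derive_n (fun z => y t z) 2 x
          - 4 * u t x * Derive (fun z => Derive (fun s => y s z) t) x
          - 2 * Derive (fun z => u t z) x * Derive (fun s => y s x) t)).
Proof.
  assert (Hb := fun t x Ht => burgers_equation M a b g u t x Hgu Ht).
  split; [exact Hb|]. intros y Hy. unfold jacobi.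
  assert (Hop := fun t x Ht => jacobi_operator M a b u y t x
    (proj1 (proj2 Hgu)) Hy Ht (fun z => Hb t z Ht)).
  split; intros H t x Ht; specialize (H t x Ht); specialize (Hop t x Ht).
  - rewrite Hop in H.
    change (Derive_n (fun s => y s x) 2 t)
      with (Derive (fun s => Derive (fun r => y r x) s) t).
    change (Derive_n (fun z => y t z) 2 x) with (Derive (Derive (y t)) x).
    change (fun z => u t z) with (u t). lra.
  - rewrite Hop.
    change (Derive_n (fun s => y s x) 2 t)
      with (Derive (fun s => Derive (fun r => y r x) s) t) in H.
    change (Derive_n (fun z => y t z) 2 x) with (Derive (Derive (y t)) x) in H.
    change (fun z => u t z) with (u t) in H. lra.
Qed.
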